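(* Let $G:=\widetilde{G}/\Gamma$ be a connected complex almost Abelian Lie group, where $\widetilde{G}$ is its simply connected universal cover and $\Gamma\subseteq\widetilde{G}$ is a discrete normal subgroup. Then $G$ is not compact.
   Context: All Lie groups and Lie algebras are finite-dimensional and complex. An almost Abelian Lie algebra is a non-Abelian Lie algebra having an Abelian subalgebra of codimension 1; a connected almost Abelian Lie group is a connected complex Lie group whose Lie algebra is almost Abelian. *)

(* Defs.v *)
From HB Require Import structures.
From mathcomp Require Import all_boot all_order all_algebra.
From mathcomp Require Import complex.
From mathcomp Require Import all_classical all_reals all_analysis.

Set Implicit Arguments.
Unset Strict Implicit.
Unset Printing Implicit Defensive.

Import Order.TTheory GRing.Theory Num.Theory.
Import numFieldNormedType.Exports.

Local Open Scope classical_set_scope.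
Local Open Scope ring_scope.
Local Open Scope complex_scope.

(** * Complex manifolds *)

(** Declared as a [numFieldType] so that 'rV[CC R]_n receives the normed module
    structure of MathComp-Analysis over the complex field [R[i]]. *)
Definition CC (R : realType) : numFieldType := R[i].

(** A chart with values in C^n: a homeomorphism from the open set [chart_dom]
    onto the open set [chart_map @` chart_dom]. Both [chart_map] and [chart_inv]
    are total functions whose values outside these sets are irrelevant. *)
Record chart (R : realType) (n : nat) (M : topologicalType) := Chart {
  chart_dom : set M ;
  chart_map :> M -> 'rV[CC R]_n ;
  chart_inv : 'rV[CC R]_n -> M ;
  chart_dom_open : open chart_dom ;
  chart_img_open : open (chart_map @` chart_dom) ;
  chart_map_continuous :
    forall x, chart_dom x -> {for x, continuous chart_map} ;
  chart_inv_continuous :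
    forall z, (chart_map @` chart_dom) z -> {for z, continuous chart_inv} ;
  chart_mapK : forall x, chart_dom x -> chart_inv (chart_map x) = x
}.

(** Over the field [CC R], [differentiable] is complex Frechet
    differentiability; a map is holomorphic on an open set when it is
    differentiable in this sense at each point of that set. *)
HB.mixin Record isComplexManifold (R : realType) (n : nat) M
    of Topological M := {
  atlas : set (chart R n M) ;
  atlas_cover : forall x : M, exists2 c, atlas c & chart_dom c x ;
  atlas_compatible : forall c d, atlas c -> atlas d ->
    forall x : M, chart_dom c x -> chart_dom d x ->
      differentiable (fun z => d (chart_inv c z)) (c x) ;
  manifold_hausdorff : hausdorff_space M ;
  manifold_second_countable : @second_countable M
}.

#[short(type="complexManifoldType")]
HB.structure Definition ComplexManifold (R : realType) (n : nat) :=
  { M of isComplexManifold R n M & Topological M }.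

Section Holomorphic.
Variables (R : realType) (m n : nat).
Variables (M : complexManifoldType R m) (N : complexManifoldType R n).

(** Meant for open [U]. *)
Definition holomorphic_on (U : set M) (f : M -> N) : Prop :=
  forall x, U x -> {for x, continuous f} /\
    forall (c : chart R m M) (d : chart R n N), atlas c -> atlas d ->
      chart_dom c x -> chart_dom d (f x) ->
      differentiable (fun z => d (f (chart_inv c z))) (c x).

End Holomorphic.

Section Covering.
Variables (R : realType) (m n : nat).
Variables (M : complexManifoldType R m) (N : complexManifoldType R n).

Definition biholomorphic_on (U : set M) (V : set N) (f : M -> N) : Prop :=
  exists g : N -> M,
    [/\ holomorphic_on U f, holomorphic_on V g,
        forall x, U x -> V (f x) /\ g (f x) = x &
        forall y, V y -> U (g y) /\ f (g y) = y].

Definition holomorphic_covering (p : M -> N) : Prop :=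
  (forall y, exists x, p x = y) /\
  forall y, exists V : set N, [/\ open V, V y &
    exists F : set (set M),
      [/\ forall U, F U -> open U,
          forall U U', F U -> F U' -> U `&` U' !=set0 -> U = U',
          \bigcup_(U in F) U = p @^-1` V &
          forall U, F U -> biholomorphic_on U V p]].

End Covering.

(** * Simple connectedness *)

Section SimplyConnected.
Variables (R : realType) (T : topologicalType).

Definition is_path (g : R -> T) (x y : T) : Prop :=
  [/\ {within `[0, 1], continuous g}, g 0 = x & g 1 = y].

Definition path_homotopic (f g : R -> T) (x y : T) : Prop :=
  exists H : R * R -> T,
    [/\ {within `[0, 1] `*` `[0, 1], continuous H},
        forall t : R, t \in `[0, 1] -> H (0, t) = f t /\ H (1, t) = g t &
        forall s : R, s \in `[0, 1] -> H (s, 0) = x /\ H (s, 1) = y].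

Definition simply_connected : Prop :=
  (exists x : T, True) /\
  (forall x y : T, exists g, is_path g x y) /\
  (forall (x : T) (g : R -> T), is_path g x x ->
     path_homotopic g (fun _ => x) x x).

End SimplyConnected.

(** * Complex Lie groups *)

HB.structure Definition GroupComplexManifold (R : realType) (n : nat) :=
  { G of ComplexManifold R n G & Group G }.

HB.mixin Record isComplexLieGroup (R : realType) (n : nat) G
    of GroupComplexManifold R n G := {
  mulg_continuous : continuous (fun xy : G * G => (xy.1 * xy.2)%g) ;
  mulg_holomorphic :
    forall (x y : G) (c d e : chart R n G), atlas c -> atlas d -> atlas e ->
      chart_dom c x -> chart_dom d y -> chart_dom e (x * y)%g ->
      differentiable
        (fun z : 'rV[CC R]_n * 'rV[CC R]_n =>
           e (chart_inv c z.1 * chart_inv d z.2)%g) (c x, d y) ;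
  invg_holomorphic : holomorphic_on [set: G] (fun x : G => (x^-1)%g)
}.

#[short(type="complexLieGroupType")]
HB.structure Definition ComplexLieGroup (R : realType) (n : nat) :=
  { G of isComplexLieGroup R n G & GroupComplexManifold R n G }.

(** * Lie algebras *)

Section AlmostAbelian.
Variables (F : fieldType) (V : vectType F) (br : V -> V -> V).

Definition abelian_subalgebra (U : {vspace V}) : Prop :=
  (forall x y, x \in U -> y \in U -> br x y \in U) /\
  (forall x y, x \in U -> y \in U -> br x y = 0).

Definition almost_abelian_bracket : Prop :=
  ~ abelian_subalgebra fullv /\
  exists U : {vspace V}, abelian_subalgebra U /\ (\dim U).+1 = \dim {: V}.

End AlmostAbelian.

Section LieAlgebra.
Variables (R : realType) (n : nat) (G : complexLieGroupType R n).

(** The tangent space at 1 is identified with C^n through a fixed chart at 1;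
    another choice of chart gives an isomorphic Lie algebra. *)
Definition chart1 : chart R n G := projT1 (cid2 (atlas_cover (1%g : G))).

Definition Ad (g : G) : 'rV[CC R]_n -> 'rV[CC R]_n :=
  'd (fun z => chart1 (g * chart_inv chart1 z * g^-1)%g) (chart1 1%g).

(** [X, Y] = ad X Y, where ad is the differential of Ad at 1. *)
Definition lie_bracket (X Y : 'rV[CC R]_n) : 'rV[CC R]_n :=
  'd (fun z => Ad (chart_inv chart1 z) Y) (chart1 1%g) X.

Definition almost_abelian_group : Prop := almost_abelian_bracket lie_bracket.

End LieAlgebra.

(** * Quotients by discrete normal subgroups *)

Section Quotient.
Variables (R : realType) (n : nat) (Gt G : complexLieGroupType R n).

Definition normal_subgroup (H : set Gt) : Prop :=
  [/\ H 1%g,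
      forall x y, H x -> H y -> H (x * y)%g,
      forall x, H x -> H (x^-1)%g &
      forall x g, H x -> H (g * x * g^-1)%g].

Definition discrete_subset (H : set Gt) : Prop := H `<=` isolated H.

(** [p] exhibits [G] as the complex Lie group [Gt / H]: it is the quotient
    morphism, it has kernel [H], and the complex structure of [G] is the one
    making [p] a holomorphic covering. *)
Definition is_quotient_by (H : set Gt) (p : Gt -> G) : Prop :=
  [/\ forall x y, p (x * y)%g = (p x * p y)%g,
      forall x, p x = 1%g <-> H x &
      holomorphic_covering p].

End Quotient.

(* Main.v *)
(** If [G] is compact, then for [w] close to 1 the whole conjugacy class of [w]
    stays in a chart at 1, so [x |-> x * w * x^-1] is in that chart a holomorphic
    map from the compact connected manifold [G] to C^n, hence constant. Thus
    [Ad] is trivial and the Lie bracket vanishes, while an almost Abelian Lie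
    algebra is not Abelian.

    Since holomorphic only means complex differentiable, the maximum principle
    behind the constancy goes through Goursat's bisection: in logarithmic polar
    coordinates it shows that the mean of [Re h] over a circle does not depend
    on the radius. *)

Require Import Defs.
From HB Require Import structures.
From mathcomp Require Import all_boot all_order all_algebra.
From mathcomp Require Import complex.
From mathcomp Require Import all_classical all_reals all_analysis.
From mathcomp Require Import ring lra.

Set Implicit Arguments.
Unset Strict Implicit.
Unset Printing Implicit Defensive.

Import Order.TTheory GRing.Theory Num.Theory.
Import numFieldNormedType.Exports.

Local Open Scope classical_set_scope.
Local Open Scope ring_scope.

(** * First-order estimates for differentiable maps *)

Lemma differentiable_approx (K : numFieldType) (V W : normedModType K)
  (f : V -> W) (x : V) : differentiable f x ->
  forall e : K, 0 < e ->
  \forall y \near x, `|f y - f x - 'd f x (y - x)| <= e * `|y - x|.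
Proof.
move=> /diff_locally /eqaddoP fx e e0; move: (fx e e0).
rewrite [in X in _ -> X](near_shift 0 x); apply: filterS => y /=.
by rewrite !fctE /= subr0 addrK opprD addrA.
Qed.

(** Subtract the expansions of [f] at [x] taken in [y] and in [z]. Both points move, as needed to
    compare opposite sides of a small rectangle containing [x]. *)
Lemma differentiable_increment (K : numFieldType) (V W : normedModType K)
  (f : V -> W) (x : V) : differentiable f x ->
  forall e : K, 0 < e -> exists2 d : K, 0 < d &
  forall y z, `|y - x| < d -> `|z - x| < d ->
    `|f y - f z - 'd f x (y - z)| <= e * (`|y - x| + `|z - x|).
Proof.
move=> fx e e0; have := differentiable_approx fx e0.
move=> /nbhs_normP [d /= d0 dP]; exists d => // y z yd zd.
have -> : f y - f z - 'd f x (y - z) =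
    (f y - f x - 'd f x (y - x)) - (f z - f x - 'd f x (z - x)).
  have -> : y - z = (y - x) - (z - x) by rewrite opprB addrA subrK.
  rewrite linearB /= [f y - f x - _]addrAC [f z - f x - _]addrAC.
  rewrite [in RHS]opprB [RHS]addrA subrK !opprB [LHS]addrACA [RHS]addrACA.
  by rewrite (addrC (- f z)).
apply: le_trans (ler_normB _ _) _; rewrite mulrDr.
by apply: lerD; apply: dP; rewrite /= distrC.
Qed.

Lemma approx_is_diff (K : numFieldType) (V W : normedModType K)
  (f : V -> W) (df : {linear V -> W}) (x : V) : continuous df ->
  (forall e : K, 0 < e ->
    \forall y \near x, `|f y - f x - df (y - x)| <= e * `|y - x|) ->
  is_diff x f df.
Proof.
move=> dfc fx.
have fo : f \o shift x = cst (f x) + df +o_0 id.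
  apply/eqaddoP => e e0; move: (fx e e0).
  rewrite [in X in X -> _](near_shift 0 x); apply: filterS => h /=.
  by rewrite !fctE /= subr0 addrK opprD addrA.
have fE := diff_unique dfc fo.
split => //; apply/diff_locallyP; rewrite fE; split => //.
Qed.

(** * Goursat's bisection *)

Section Rectangles.
Variable R : realType.
Implicit Types (W u v : R -> R -> R).

(** When each [W x] is a primitive of [u x], this is the integral of [u] along the side x = b minus
    the one along x = a; it stands in for the contour integrals of Goursat's argument. *)
Definition rect_diff W (a b c d : R) : R := W b d - W b c - W a d + W a c.

(** [rect_diff] is additive over the four quarters; were all of them below [K], the whole would be
    below 4K. *)
Lemma rect_diff_quarter W (a c l w K : R) :
  K * 4 <= `|rect_diff W a (a + (l + l)) c (c + (w + w))| ->
  exists a' c', [/\ a' = a \/ a' = a + l, c' = c \/ c' = c + w &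
    K <= `|rect_diff W a' (a' + l) c' (c' + w)|].
Proof.
move=> KW; apply: contrapT => no.
move: KW; apply/negP; rewrite -ltNge.
have small a' c' : a' = a \/ a' = a + l -> c' = c \/ c' = c + w ->
    `|rect_diff W a' (a' + l) c' (c' + w)| < K.
  move=> ha hc; rewrite ltNge; apply/negP => KW'; apply: no.
  by exists a', c'.
have -> : rect_diff W a (a + (l + l)) c (c + (w + w)) =
    rect_diff W a (a + l) c (c + w) +
    rect_diff W (a + l) (a + l + l) c (c + w) +
    rect_diff W a (a + l) (c + w) (c + w + w) +
    rect_diff W (a + l) (a + l + l) (c + w) (c + w + w).
  by rewrite /rect_diff !addrA; ring.
apply: le_lt_trans (ler_normD _ _) _.
apply: le_lt_trans (lerD (ler_normD _ _) (lexx _)) _.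
apply: le_lt_trans (lerD (lerD (ler_normD _ _) (lexx _)) (lexx _)) _.
have -> : K * 4 = K + K + K + K by ring.
by apply: ltrD; [apply: ltrD; [apply: ltrD|]|]; apply: small; auto.
Qed.

Lemma nested_segments (a l : nat -> R) :
  (forall n, a n <= a n.+1 /\ a n.+1 + l n.+1 <= a n + l n) ->
  (forall n, 0 <= l n) ->
  exists p, forall n, a n <= p <= a n + l n.
Proof.
move=> al l0.
have am n m : (n <= m)%N -> a n <= a m.
  elim: m => [|m IH]; first by rewrite leqn0 => /eqP ->.
  rewrite leq_eqVlt => /predU1P[->//|]; rewrite ltnS => /IH /le_trans; apply.
  by have [] := al m.
have alm n m : (n <= m)%N -> a m + l m <= a n + l n.
  elim: m => [|m IH]; first by rewrite leqn0 => /eqP ->.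
  rewrite leq_eqVlt => /predU1P[->//|]; rewrite ltnS => /IH; apply: le_trans.
  by have [] := al m.
have ub n : ubound (range a) (a n + l n).
  move=> _ [m _ <-]; have [nm|/ltnW mn] := leqP n m.
    by apply: le_trans (alm _ _ nm); rewrite lerDl.
  by apply: (le_trans (am _ _ mn)); rewrite lerDl.
exists (sup (range a)) => n; apply/andP; split.
  by apply: ub_le_sup; [exists (a 0%N + l 0%N); exact: ub | exists n].
by apply: ge_sup => //; exists (a 0%N), 0%N.
Qed.

(** Otherwise bisection gives nested rectangles, with sides halved at each step, on which
    [rect_diff] is at least K / 4^n in absolute value. The local bound at their common point is
    quadratic in the sides and contradicts this. *)
Lemma rect_diff_eq0 W (a c l w : R) : 0 <= l -> 0 <= w ->
  (forall x y, a <= x <= a + l -> c <= y <= c + w ->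
    forall e, 0 < e -> exists2 d, 0 < d &
    forall a' c' l' w', 0 <= l' <= d -> 0 <= w' <= d ->
      a <= a' -> a' + l' <= a + l -> c <= c' -> c' + w' <= c + w ->
      a' <= x <= a' + l' -> c' <= y <= c' + w' ->
      `|rect_diff W a' (a' + l') c' (c' + w')| <= e * (l' + w') ^+ 2) ->
  rect_diff W a (a + l) c (c + w) = 0.
Proof.
move=> l0 w0 local; apply/eqP; rewrite -normr_le0 leNgt; apply/negP.
set K := `|_| => K0.
pose L (n : nat) : R := l * 2^-1 ^+ n; pose D (n : nat) : R := w * 2^-1 ^+ n.
have h0 n : 0 < 2^-1 ^+ n :> R by rewrite exprn_gt0 // invr_gt0.
have L0 n : 0 <= L n by rewrite /L mulr_ge0 // ltW.
have D0 n : 0 <= D n by rewrite /D mulr_ge0 // ltW.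
have LS n : L n = L n.+1 + L n.+1 by rewrite /L exprS; field.
have DS n : D n = D n.+1 + D n.+1 by rewrite /D exprS; field.
pose good n (q : R * R) := [/\ a <= q.1 /\ q.1 + L n <= a + l,
   c <= q.2 /\ q.2 + D n <= c + w &
   K * (2^-1 ^+ n) ^+ 2 <=
     `|rect_diff W q.1 (q.1 + L n) q.2 (q.2 + D n)|].
(* Guarded by [good n q], so that every [q] has a successor and [choice] applies; when [q] is not
   good, any value serves. *)
pose next n (q q' : R * R) := good n q -> [/\ good n.+1 q',
   q.1 <= q'.1 /\ q'.1 + L n.+1 <= q.1 + L n &
   q.2 <= q'.2 /\ q'.2 + D n.+1 <= q.2 + D n].
have step (nq : nat * (R * R)) : exists q', next nq.1 nq.2 q'.
  case: nq => n q /=; case: (pselect (good n q)) => [gq|nq]; last first.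
    by exists q => /nq.
  case: (gq) => -[q1 q2] [q3 q4] qK.
  have [] := @rect_diff_quarter W q.1 q.2 (L n.+1) (D n.+1)
     (K * (2^-1 ^+ n.+1) ^+ 2).
    rewrite -LS -DS; apply: le_trans qK; rewrite (exprS _ n).
    by rewrite le_eqVlt; apply/orP; left; apply/eqP; field.
  move=> a' [c' [ha hc aK]]; exists (a', c') => _; rewrite /good /=.
  have := L0 n.+1; have := D0 n.+1; have := LS n; have := DS n => e1 e2 p1 p2.
  have [A1 A2] : q.1 <= a' /\ a' + L n.+1 <= q.1 + L n by case: ha => ->; lra.
  have [C1 C2] : q.2 <= c' /\ c' + D n.+1 <= q.2 + D n by case: hc => ->; lra.
  by split; [split; [lra|lra|exact: aK]|lra|lra].
have [nx nxP] := choice step.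
pose q := fix q n := if n is m.+1 then nx (m, q m) else (a, c).
have gq n : good n (q n).
  elim: n => [|n /(nxP (n, _)) []//].
  rewrite /good /= /L /D !expr0 !mulr1 expr1n mulr1; split => //.
have nq n : next n (q n) (q n.+1) by exact: (nxP (n, q n)).
have [x xP] : exists x, forall n, (q n).1 <= x <= (q n).1 + L n.
  by apply: nested_segments => // n; case: (nq n (gq n)).
have [y yP] : exists y, forall n, (q n).2 <= y <= (q n).2 + D n.
  by apply: nested_segments => // n; case: (nq n (gq n)).
have lw0 : 0 < l + w.
  rewrite lt_neqAle addr_ge0 // andbT eq_sym; apply/negP => /eqP lw.
  have [l00 w00] : l = 0 /\ w = 0 by split; lra.
  by move: K0; rewrite /K /rect_diff l00 w00 !addr0 normr_gt0 => /eqP; apply; ring.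
have xa : a <= x <= a + l by have := xP 0%N; rewrite /L expr0 mulr1.
have yc : c <= y <= c + w by have := yP 0%N; rewrite /D expr0 mulr1.
(* With this [e] the local bound on the n-th rectangle is half of K / 4^n. *)
have e0 : 0 < K / 2 / (l + w) ^+ 2 by rewrite !divr_gt0 // exprn_gt0.
have [d d0 dP] := local x y xa yc _ e0.
have [n nd] : exists n, (l + w) * 2^-1 ^+ n <= d.
  (* Large enough because 2^n > n > (l + w) / d. *)
  pose n := (Num.trunc ((l + w) / d)).+1; exists n.
  rewrite exprVn ler_pdivrMr ?exprn_gt0 // mulrC -ler_pdivrMr //.
  apply: (@le_trans _ _ n%:R).
    by apply/ltW; rewrite truncnS_gt //; exact: num_real.
  by rewrite -natrX ler_nat ltnW // ltn_expl.
have [[q1 q2] [q3 q4] qK] := gq n.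
have Ld : 0 <= L n <= d.
  rewrite L0 /=; apply: le_trans nd; rewrite /L ler_wpM2r ?(ltW (h0 n)) //; lra.
have Dd : 0 <= D n <= d.
  rewrite D0 /=; apply: le_trans nd; rewrite /D ler_wpM2r ?(ltW (h0 n)) //; lra.
have := dP _ _ _ _ Ld Dd q1 q2 q3 q4 (xP n) (yP n).
move=> /(le_trans qK); rewrite /L /D -mulrDl exprMn.
have -> : K / 2 / (l + w) ^+ 2 * ((l + w) ^+ 2 * (2^-1 ^+ n) ^+ 2) =
   K / 2 * (2^-1 ^+ n) ^+ 2 by field; lra.
rewrite ler_pM2r ?exprn_gt0 //; move: K0; lra.
Qed.

End Rectangles.

Section Green.
Variable R : realType.
Implicit Types (U V u v : R -> R -> R).

(** Mean value theorem for [U b - U a], whose derivative [u b - u a] stays within [e] of [k]. *)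
Lemma rect_diff_approx U u (a b c d k e : R) : c <= d ->
  (forall y, c <= y <= d -> is_derive y 1 (U a) (u a y)) ->
  (forall y, c <= y <= d -> is_derive y 1 (U b) (u b y)) ->
  (forall y, c <= y <= d -> `|u b y - u a y - k| <= e) ->
  `|rect_diff U a b c d - k * (d - c)| <= e * (d - c).
Proof.
move=> cd Ua Ub uk.
pose D t := U b t - U a t.
have dD t : t \in `[c, d] -> is_derive t 1 D (u b t - u a t).
  by rewrite in_itv /= => tcd; apply: is_deriveB; auto.
have cD : {within `[c, d], continuous D}.
  by apply: derivable_within_continuous => t /dD [].
have [t tcd E] : exists2 t, t \in `[c, d] & D d - D c = (u b t - u a t) * (d - c).
  have dDo t : t \in `]c, d[ -> is_derive t 1 D (u b t - u a t).
    by move=> tcd; apply: dD; exact: subset_itv_oo_cc tcd.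
  exact: (@MVT_segment R D (fun t => u b t - u a t) c d cd dDo cD).
rewrite in_itv /= in tcd.
have -> : rect_diff U a b c d - k * (d - c) = (u b t - u a t - k) * (d - c).
  by rewrite /rect_diff mulrBl -E /D; ring.
rewrite normrM [`|d - c|]ger0_norm ?subr_ge0 // ler_wpM2r ?subr_ge0 //.
by apply: uk.
Qed.

(* Goursat's form of Green's theorem: the partial derivatives need not be
   continuous, only [u] and [v] have to be differentiable. *)
Lemma green_rect U V u v (a c l w : R) : 0 <= l -> 0 <= w ->
  (forall x y, a <= x <= a + l -> c <= y <= c + w ->
     is_derive y 1 (U x) (u x y)) ->
  (forall x y, a <= x <= a + l -> c <= y <= c + w ->
     is_derive x 1 (V^~ y) (v x y)) ->
  (forall x y, a <= x <= a + l -> c <= y <= c + w ->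
     [/\ differentiable (fun p : R * R => u p.1 p.2) (x, y),
         differentiable (fun p : R * R => v p.1 p.2) (x, y) &
         'd (fun p : R * R => u p.1 p.2) (x, y) (1, 0) =
         'd (fun p : R * R => v p.1 p.2) (x, y) (0, 1)]) ->
  rect_diff U a (a + l) c (c + w) = rect_diff V a (a + l) c (c + w).
Proof.
move=> l0 w0 Uu Vv uv.
suff : rect_diff (fun x y => U x y - V x y) a (a + l) c (c + w) = 0.
  by rewrite /rect_diff; lra.
apply: rect_diff_eq0 => // x y xa yc e e0.
have [du dv E] := uv x y xa yc.
set f := (fun p : R * R => u p.1 p.2) in du E.
set g := (fun p : R * R => v p.1 p.2) in dv E.
(* To first order both [rect_diff] equal [k] times the area of the small rectangle, so these terms
   cancel and only an error of at most e (l' + w')^2 is left. *)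
set k := 'd f (x, y) (1, 0) in E.
have e2 : 0 < e / 2 by rewrite divr_gt0.
have [d1 d10 fP] := differentiable_increment du e2.
have [d2 d20 gP] := differentiable_increment dv e2.
(* Halved so that distances at most [d] meet the strict bounds of [fP] and [gP]. *)
pose d := Num.min d1 d2 / 2.
have d0 : 0 < d by rewrite divr_gt0 // lt_min d10.
have dmin : d < Num.min d1 d2 by rewrite ltr_pdivrMr // ltr_pMr ?ltr1n // lt_min d10.
have [dd1 dd2] : d < d1 /\ d < d2 by move: dmin; rewrite lt_min => /andP[].
exists d => // a' c' l' w' /andP[l'0 l'd] /andP[w'0 w'd] aa' al' cc' cw'.
move=> /andP[ax xl] /andP[cy yw].
have near_corner M x' y' : a' <= x' <= a' + l' -> c' <= y' <= c' + w' ->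
    l' <= M -> w' <= M -> `|(x', y') - (x, y)| <= M.
  move=> /andP[? ?] /andP[? ?] lM wM.
  change (Num.max `|x' - x| `|y' - y| <= M).
  move: aa' al' cc' cw' => _ _ _ _.
  by rewrite ge_max !ler_norml; apply/andP; split; lra.
have corner x' y' : a' <= x' <= a' + l' -> c' <= y' <= c' + w' ->
    `|(x', y') - (x, y)| <= l' + w' /\ `|(x', y') - (x, y)| <= d.
  by move=> ? ?; split; apply: near_corner => //; rewrite ?lerDl ?lerDr.
have a'l : a' <= a' <= a' + l' by rewrite lexx lerDl.
have l'a : a' <= a' + l' <= a' + l' by rewrite lexx lerDl l'0.
have c'w : c' <= c' <= c' + w' by rewrite lexx lerDl.
have w'c : c' <= c' + w' <= c' + w' by rewrite lexx lerDl w'0.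
have fk y' : c' <= y' <= c' + w' ->
    `|u (a' + l') y' - u a' y' - k * l'| <= e * (l' + w').
  move=> y'P.
  have [N1 D1] := corner _ _ l'a y'P; have [N2 D2] := corner _ _ a'l y'P.
  have := fP _ _ (le_lt_trans D1 dd1) (le_lt_trans D2 dd1).
  have -> : (a' + l', y') - (a', y') = l' *: (1, 0) :> R * R.
    by congr pair; rewrite /= ?scaler0 /GRing.scale /=; ring.
  rewrite linearZ /= [_ *: _]mulrC => /le_trans; apply.
  rewrite -mulrA ler_pM2l // mulrC ler_pdivrMr //.
  by rewrite mulrDr mulr1; apply: lerD.
have gk x' : a' <= x' <= a' + l' ->
    `|v x' (c' + w') - v x' c' - k * w'| <= e * (l' + w').
  move=> x'P.
  have [N1 D1] := corner _ _ x'P w'c; have [N2 D2] := corner _ _ x'P c'w.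
  have := gP _ _ (le_lt_trans D1 dd2) (le_lt_trans D2 dd2).
  have -> : (x', c' + w') - (x', c') = w' *: (0, 1) :> R * R.
    by congr pair; rewrite /= ?scaler0 /GRing.scale /=; ring.
  rewrite linearZ /= -E [_ *: _]mulrC => /le_trans; apply.
  rewrite -mulrA ler_pM2l // mulrC ler_pdivrMr //.
  by rewrite mulrDr mulr1; apply: lerD.
have inx x' : a' <= x' <= a' + l' -> a <= x' <= a + l.
  by move=> /andP[h1 h2]; rewrite (le_trans aa' h1) (le_trans h2 al').
have iny y' : c' <= y' <= c' + w' -> c <= y' <= c + w.
  by move=> /andP[h1 h2]; rewrite (le_trans cc' h1) (le_trans h2 cw').
have HU : `|rect_diff U a' (a' + l') c' (c' + w') - k * l' * w'| <=
    e * (l' + w') * w'.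
  have := @rect_diff_approx U u a' (a' + l') c' (c' + w') (k * l')
    (e * (l' + w')).
  rewrite (addrAC c') subrr add0r; apply => //; first by rewrite lerDl.
  - by move=> y' y'P; apply: Uu; [exact: inx | exact: iny].
  - by move=> y' y'P; apply: Uu; [exact: inx | exact: iny].
have HV : `|rect_diff V a' (a' + l') c' (c' + w') - k * w' * l'| <=
    e * (l' + w') * l'.
  (* [V] is a primitive in its first argument, so the coordinates trade places. *)
  have := @rect_diff_approx (fun y x => V x y) (fun y x => v x y)
    c' (c' + w') a' (a' + l') (k * w') (e * (l' + w')).
  rewrite (addrAC a') subrr add0r => H.
  have -> : rect_diff V a' (a' + l') c' (c' + w') =
    rect_diff (fun y x => V x y) c' (c' + w') a' (a' + l').
    by rewrite /rect_diff; ring.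
  apply: H => //; first by rewrite lerDl.
  - by move=> x' x'P; apply: Vv; [exact: inx | exact: iny].
  - by move=> x' x'P; apply: Vv; [exact: inx | exact: iny].
have -> : rect_diff (fun x y => U x y - V x y) a' (a' + l') c' (c' + w') =
   (rect_diff U a' (a' + l') c' (c' + w') - k * l' * w') -
   (rect_diff V a' (a' + l') c' (c' + w') - k * w' * l').
  by rewrite /rect_diff; ring.
apply: (le_trans (ler_normB _ _)); apply: (le_trans (lerD HU HV)).
by rewrite -mulrDr expr2 mulrA [w' + l']addrC.
Qed.

Lemma exists_primitive (f : R -> R) (a b : R) : a < b ->
  {within `[a, b], continuous f} ->
  exists F, forall x, a < x < b -> is_derive x 1 F (f x).
Proof.
move=> ab cf; exists (parameterized_integral lebesgue_measure a ^~ f).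
move=> x /andP[ax xb].
have intf : lebesgue_measure.-integrable `[a, b] (EFin \o f).
  by apply: continuous_compact_integrable cf; exact: segment_compact.
have fx : {for x, continuous f}.
  by apply: within_continuous_continuous cf _ => //; rewrite in_itv /= ax.
have [dF E] := continuous_FTC1_closed xb intf ax fx.
by split; [exact: dF | rewrite -derive1E; exact: E].
Qed.

End Green.

(** * Maximum principle for complex differentiable functions *)

Section ComplexPlane.
Variable R : realType.
Local Open Scope complex_scope.
Local Notation Re := (@complex.Re R).
Local Notation Im := (@complex.Im R).

Lemma normc_complex_le (x y : R) : `|(x +i* y) : CC R| <= (`|x| + `|y|)%:C.
Proof.
have -> : (x +i* y : CC R) = x%:C + 'i * y%:C by simpc.
apply: le_trans (ler_normD _ _) _; rewrite normrM !normc_def /=.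
by simpc; rewrite !expr0n !(addr0, add0r) expr1n !sqrtr_sqr sqrtr1 mul1r lexx.
Qed.

Lemma Re_norm_le (z : CC R) (e : R) : `|z| <= e%:C -> `|Re z| <= e.
Proof. by move=> ze; rewrite -lecR; apply: le_trans (normc_ge_Re z) ze. Qed.

(** The real differential of [Re h] at a point where [h] has complex derivative [A]. *)
Definition Re_mul (A : CC R) (k : R * R) : R := Re (A * (k.1 +i* k.2)).

Lemma Re_mulE A k : Re_mul A k = Re A * k.1 - Im A * k.2.
Proof. by case: A. Qed.

Lemma Re_mul_linear A : linear (Re_mul A).
Proof. by move=> a x y; rewrite !Re_mulE /= /GRing.scale /=; ring. Qed.

HB.instance Definition _ (A : CC R) :=
  GRing.isLinear.Build R (R * R)%type R _ (Re_mul A) (Re_mul_linear A).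

Lemma Re_mul_continuous A : continuous (Re_mul A).
Proof.
move=> k; rewrite (_ : Re_mul A = fun k => Re A * k.1 - Im A * k.2); last first.
  by apply/funext => z; exact: Re_mulE.
apply: cvgB; apply: cvgMr; [exact: cvg_fst | exact: cvg_snd].
Qed.

Lemma complex_continuous : continuous (fun q : R * R => (q.1 +i* q.2 : CC R)).
Proof.
move=> [x y]; apply/cvgrPdist_lt => e; rewrite ltcE /= => /andP[/eqP e1 e0].
have -> : e = (Re e)%:C by case: e e1 {e0} => a b /= ->.
have e2 : 0 < Re e / 2 by rewrite divr_gt0.
near=> q.
have -> : (x +i* y) - (q.1 +i* q.2) = (x - q.1) +i* (y - q.2) :> CC R by simpc.
apply: le_lt_trans (normc_complex_le _ _) _; rewrite ltcR.
have -> : Re e = Re e / 2 + Re e / 2 by lra.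
apply: ltrD; near: q.
- by apply: cvgr_dist_lt e2; exact: cvg_fst.
- by apply: cvgr_dist_lt e2; exact: cvg_snd.
Unshelve. all: by end_near. Qed.

(** This is A w = (-i A)(i w). The unreduced products are the values of the differential in
    [is_diff_cexp] on (1, 0) and (0, 1). *)
Lemma Re_mul_rotate (A : CC R) (x y : R) :
  Re_mul A (1 * x - 0 * y, 1 * y + 0 * x) =
  Re_mul (- 'i * A) (0 * x - 1 * y, 0 * y + 1 * x).
Proof. by case: A => a b; rewrite !Re_mulE /=; ring. Qed.

Lemma is_diff_Re (h : CC R -> CC R) (x y : R) :
  differentiable h (x +i* y : CC R) ->
  is_diff (x, y) (fun q : R * R => Re (h (q.1 +i* q.2)))
    (Re_mul ('d h (x +i* y : CC R) 1)).
Proof.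
move=> dh; set A := 'd h _ 1.
apply: approx_is_diff => [|e e0]; first exact: Re_mul_continuous.
(* R * R carries the maximum norm, so [|k.1| + |k.2|] may reach twice [|k|]. *)
have e2 : 0 < (e / 2)%:C :> CC R by rewrite ltcR divr_gt0.
have dhe : \forall q \near (x, y), `|h (q.1 +i* q.2) - h (x +i* y) -
    'd h (x +i* y : CC R) ((q.1 +i* q.2) - (x +i* y))| <=
    (e / 2)%:C * `|(q.1 +i* q.2 : CC R) - (x +i* y)|.
  exact: (@complex_continuous (x, y) _ (differentiable_approx dh e2)).
near=> q; have : `|h (q.1 +i* q.2) - h (x +i* y) -
    'd h (x +i* y : CC R) ((q.1 +i* q.2) - (x +i* y))| <=
    (e / 2)%:C * `|(q.1 +i* q.2 : CC R) - (x +i* y)| by near: q.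
set k := q - (x, y).
have kE : (q.1 +i* q.2) - (x +i* y) = k.1 +i* k.2 :> CC R by simpc.
rewrite kE.
have -> : 'd h (x +i* y : CC R) (k.1 +i* k.2 : CC R) = A * (k.1 +i* k.2).
  rewrite -[X in 'd h _ X = _]mulr1.
  rewrite (_ : _ * 1 = (k.1 +i* k.2 : CC R) *: (1 : CC R)) // linearZ /=.
  by rewrite /A [_ *: _]mulrC.
move=> H; rewrite /Re_mul -!raddfB; apply: Re_norm_le.
apply: le_trans H _.
apply: le_trans (ler_wpM2l (ltW e2) (normc_complex_le _ _)) _.
rewrite -rmorphM lecR -mulrA ler_pM2l // mulrC ler_pdivrMr //.
rewrite mulrDr mulr1; apply: lerD.
- change (`|k.1| <= Num.max `|k.1| `|k.2|); by rewrite le_max lexx.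
- change (`|k.2| <= Num.max `|k.1| `|k.2|); by rewrite le_max lexx orbT.
Unshelve. all: by end_near. Qed.

Lemma is_diff1 (f : R -> R) (x df : R) : is_derive x 1 f df ->
  is_diff x f (fun h : R => h * df).
Proof.
move=> [fx <-]; split; first exact/derivable1_diffP.
by rewrite (deriv1E fx) derive1E.
Qed.

(** The exponential of s + i t: [s] is the logarithm of the radius, [t] the angle. *)
Definition cexp (s t : R) : CC R := (expR s * cos t) +i* (expR s * sin t).

Lemma norm_cexp s t : `|cexp s t| = (expR s)%:C.
Proof.
rewrite normc_def /= !exprMn -mulrDr cos2Dsin2 mulr1 sqrtr_sqr.
by rewrite ger0_norm // expR_ge0.
Qed.

(** The differential multiplies k.1 + i k.2 by [cexp s t]; it is written with pairs to compose with
    [is_diff_Re]. *)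
Lemma is_diff_cexp (s t : R) :
  is_diff (s, t) (fun p : R * R => (expR p.1 * cos p.2, expR p.1 * sin p.2))
   (fun k : R * R => (k.1 * (expR s * cos t) - k.2 * (expR s * sin t),
                     k.1 * (expR s * sin t) + k.2 * (expR s * cos t))).
Proof.
have d1 : is_diff (s, t) fst fst.
  have c1 : continuous (fst : R * R -> R) by move=> k; exact: cvg_fst.
  by split; [exact: linear_differentiable c1 | exact: diff_lin c1].
have d2 : is_diff (s, t) snd snd.
  have c2 : continuous (snd : R * R -> R) by move=> k; exact: cvg_snd.
  by split; [exact: linear_differentiable c2 | exact: diff_lin c2].
have De := is_diff_comp d1 (is_diff1 (is_derive_expR s)).
have Dc := is_diff_comp d2 (is_diff1 (is_derive_cos t)).
have Ds := is_diff_comp d2 (is_diff1 (is_derive_sin t)).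
have [D Dv] := is_diff_pair (is_diffM De Dc) (is_diffM De Ds).
split; first exact: D.
apply: (etrans Dv); apply/funext => k /=.
by rewrite !fctE /GRing.scale /=; congr pair; ring.
Qed.

(** [v] is the imaginary part of [h], in a form that lets [is_diff_Re] treat both functions. The
    last clause is a Cauchy-Riemann equation, from [Re_mul_rotate]. *)
Lemma cauchy_riemann_polar (h : CC R -> CC R) (s t : R) :
  differentiable h (cexp s t) ->
  let u p := Re (h (cexp p.1 p.2)) in
  let v p := Re (- 'i * h (cexp p.1 p.2)) in
  [/\ differentiable u (s, t), differentiable v (s, t) &
      'd u (s, t) (1, 0) = 'd v (s, t) (0, 1)].
Proof.
move=> dh u v.
pose g := (- 'i : CC R) *: h.
have di : differentiable g (cexp s t) by exact: differentiableZ.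
have Ei : 'd g (cexp s t) 1 = (- 'i : CC R) *: 'd h (cexp s t) 1.
  have E := @diffZ (CC R) (CC R) (CC R) h (- 'i : CC R) (cexp s t) dh.
  exact: (congr1 (fun f : CC R -> CC R => f 1) E).
have [du Eu] := is_diff_comp (is_diff_cexp s t) (is_diff_Re dh).
have [dv Ev] := is_diff_comp (is_diff_cexp s t) (is_diff_Re di).
split; [exact: du | exact: dv | ].
apply: (etrans (congr1 (fun f : R * R -> R => f (1, 0)) Eu)).
apply: (etrans _ (esym (congr1 (fun f : R * R -> R => f (0, 1)) Ev))).
apply: (etrans (Re_mul_rotate ('d h (cexp s t) 1) _ _)).
exact: (congr1 (fun A => Re_mul A _) (esym Ei)).
Qed.

End ComplexPlane.

(** * Maximum of the real part at the centre of a disk *)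

Section RealPartMaximum.
Variable R : realType.
Local Open Scope complex_scope.
Local Notation Re := (@complex.Re R).

(** Choosing primitives by one operator makes equal functions have equal primitives, which the
    periodicity argument relies on. *)
Lemma primitive_operator (a b : R) : a < b ->
  exists P : (R -> R) -> R -> R, forall f : R -> R,
    {within `[a, b], continuous f} ->
    forall x, a < x < b -> is_derive x 1 (P f) (f x).
Proof.
move=> ab; have H (f : R -> R) : exists F : R -> R,
    {within `[a, b], continuous f} ->
    forall x, a < x < b -> is_derive x 1 F (f x).
  case: (pselect {within `[a, b], continuous f}) => [cf|ncf].
    by have [F FP] := exists_primitive ab cf; exists F.
  by exists f => /ncf.
by have [P PP] := choice H; exists P.
Qed.

Lemma MVT_derive (F f : R -> R) (a b : R) : a <= b ->
  (forall x, a <= x <= b -> is_derive x 1 F (f x)) ->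
  exists2 c, a <= c <= b & F b - F a = f c * (b - a).
Proof.
move=> ab Ff.
have dF x : x \in `[a, b] -> is_derive x 1 F (f x).
  by rewrite in_itv /=; exact: Ff.
have dFo x : x \in `]a, b[ -> is_derive x 1 F (f x).
  by move=> xab; apply: dF; exact: subset_itv_oo_cc xab.
have cF : {within `[a, b], continuous F}.
  by apply: derivable_within_continuous => x /dF [].
have [c cab E] := @MVT_segment R F f a b ab dFo cF.
by exists c => //; move: cab; rewrite in_itv.
Qed.

Lemma cexp_periodic (s : R) : cexp s (pi *+ 2) = cexp s 0.
Proof. by rewrite /cexp cos2pi sin2pi cos0 sin0. Qed.

Variable h : CC R -> CC R.
(** In logarithmic polar coordinates this disk without its centre is s < 1, which leaves room around
    the unit circle s = 0. *)
Hypothesis dh : forall z, `|z| < (expR 1)%:C -> differentiable h z.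

Let u (s t : R) := Re (h (cexp s t)).
Let v (s t : R) := Re (- 'i * h (cexp s t)).

Let duv (s t : R) : s < 1 ->
  [/\ differentiable (fun p : R * R => u p.1 p.2) (s, t),
      differentiable (fun p : R * R => v p.1 p.2) (s, t) &
      'd (fun p : R * R => u p.1 p.2) (s, t) (1, 0) =
      'd (fun p : R * R => v p.1 p.2) (s, t) (0, 1)].
Proof.
move=> s1; apply: cauchy_riemann_polar; apply: dh.
by rewrite norm_cexp ltcR ltr_expR.
Qed.

Let u_continuous (s : R) : s < 1 -> continuous (u s).
Proof.
move=> s1 t; have [du _ _] := duv t s1.
have := differentiable_continuous du => cu.
have ct : (fun t' => (s, t')) @ t --> (s, t).
  exact: (@cvg_pair _ _ _ (nbhs t) (nbhs s) (nbhs t) _ _ _ (cst s) id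
    (@cst_continuous _ _ s t) (@cvg_id _ _)).
exact: (cvg_comp _ _ ct cu).
Qed.

Let v_continuous (s t : R) : s < 1 -> {for s, continuous (v^~ t)}.
Proof.
move=> s1; have [_ dv _] := duv t s1.
have := differentiable_continuous dv => cv.
have cs : (fun s' => (s', t)) @ s --> (s, t).
  exact: (@cvg_pair _ _ _ (nbhs s) (nbhs s) (nbhs t) _ _ _ id (cst t)
    (@cvg_id _ _) (@cst_continuous _ _ t s)).
exact: (cvg_comp _ _ cs cv).
Qed.

(* The integral of [Re h] over a circle around 0 does not depend on the
   radius: in logarithmic polar coordinates this is Green's theorem on
   [s, 0] x [0, 2 pi], whose two horizontal sides cancel by periodicity. *)
Lemma circle_integral_constant : exists U : R -> R -> R,
  (forall s t, s <= 0 -> 0 <= t <= pi *+ 2 -> is_derive t 1 (U s) (u s t)) /\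
  forall s, s <= 0 ->
    U s (pi *+ 2) - U s 0 = U 0 (pi *+ 2) - U 0 0.
Proof.
have pi2 : 0 < pi *+ 2 :> R by rewrite mulrn_wgt0 // pi_gt0.
(* The segment is enlarged because the operator gives derivatives at interior points only. *)
have [|P PP] := @primitive_operator (- 1) (pi *+ 2 + 1); first by lra.
have Uu s t : s <= 0 -> 0 <= t <= pi *+ 2 -> is_derive t 1 (P (u s)) (u s t).
  move=> s0 /andP[t0 t2]; apply: PP; last by apply/andP; split; lra.
  by apply: continuous_subspaceT; apply: u_continuous; lra.
exists (fun s => P (u s)); split => // s s0.
(* This segment has [s, 0] in its interior and stays within s < 1. *)
have [|Q QP] := @primitive_operator (s - 1) 2^-1; first by lra.
have Vv x t : s <= x <= 0 -> is_derive x 1 (Q (v^~ t)) (v x t).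
  move=> /andP[sx x0]; apply: (QP (v^~ t)); last by apply/andP; split; lra.
  apply: continuous_in_subspaceT => y; rewrite inE /= in_itv /= => /andP[_ y2].
  by apply: v_continuous; lra.
have := @green_rect R (fun s => P (u s)) (fun x t => Q (v^~ t) x) u v
   s 0 (- s) (pi *+ 2).
rewrite addrN add0r oppr_ge0 => /(_ s0 (ltW pi2)) G.
have : rect_diff (fun s => P (u s)) s 0 0 (pi *+ 2) =
    rect_diff (fun x t => Q (v^~ t) x) s 0 0 (pi *+ 2).
  apply: G.
  - by move=> x y /andP[_ x0] y2; apply: Uu.
  - by move=> x y xs _; apply: Vv.
  - by move=> x y /andP[_ x0] _; apply: duv; lra.
have -> : rect_diff (fun x t => Q (v^~ t) x) s 0 0 (pi *+ 2) = 0.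
  have vp : v^~ (pi *+ 2) = v^~ 0.
    by apply/funext => x; rewrite /v cexp_periodic.
  by rewrite /rect_diff vp; ring.
by rewrite /rect_diff; lra.
Qed.

(** By continuity at 0 small circles have mean close to [Re (h 0)], so the unit circle has mean at
    least [Re (h 0)]. As no value exceeds it, equality holds on the circle; it is read off at
    [cexp 0 pi], which is -1. *)
Lemma Re_maximum_circle :
  (forall z, `|z| < (expR 1)%:C -> Re (h z) <= Re (h 0)) ->
  Re (h (- 1)) = Re (h 0).
Proof.
move=> hmax.
have [U [Uu UI]] := circle_integral_constant.
have pi2 : 0 < pi *+ 2 :> R by rewrite mulrn_wgt0 // pi_gt0.
have mean e : 0 < e -> (Re (h 0) - e) * (pi *+ 2) <= U 0 (pi *+ 2) - U 0 0.
  move=> e0.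
  have h0 : differentiable h 0.
    by apply: dh; rewrite normr0 ltcR expR_gt0.
  have e0' : 0 < e%:C :> CC R by rewrite ltcR.
  have := differentiable_continuous h0 => /cvgrPdist_lt /(_ _ e0').
  move=> /nbhs_normP [r /= r0 rP].
  have rE : r = (Re r)%:C.
    by move: r0; rewrite ltcE; case: (r) => a b /= /andP[/eqP -> _].
  have Rr0 : 0 < Re r by move: r0; rewrite rE ltcR.
  (* The minimum keeps [s] in the range of [UI]; subtracting 1 puts the radius strictly below
     [r]. *)
  pose s := Num.min 0 (ln (Re r) - 1).
  have s0 : s <= 0 by rewrite ge_min lexx.
  have sr : expR s < Re r.
    rewrite -[ltRHS]lnK ?posrE // ltr_expR gt_min; apply/orP; right; lra.
  rewrite -(UI s s0).
  have [t _ ->] := @MVT_derive (U s) (u s) 0 (pi *+ 2) (ltW pi2) (Uu s ^~ s0).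
  rewrite subr0 ler_pM2r // /u.
  have : `|h 0 - h (cexp s t)| < e%:C.
    by apply: rP; rewrite /= sub0r normrN norm_cexp rE ltcR.
  move=> /ltW /Re_norm_le; rewrite raddfB /= ler_norml; lra.
have mean0 : Re (h 0) * (pi *+ 2) <= U 0 (pi *+ 2) - U 0 0.
  apply/ler_addgt0Pr => e e0.
  have := mean (e / (pi *+ 2)); rewrite divr_gt0 // => /(_ isT).
  by rewrite mulrBl divfK ?gt_eqF // lerBlDr.
(* [D] is nonincreasing by [hmax], while [mean0] makes its total change nonnegative; hence it is
   constant and its derivative vanishes at [pi]. *)
pose D t := U 0 t - Re (h 0) * t.
have dD t : 0 <= t <= pi *+ 2 -> is_derive t 1 D (u 0 t - Re (h 0)).
  move=> t2; have [d1 E1] := Uu 0 t (lexx _) t2.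
  have dl : is_derive t 1 (fun t => Re (h 0) * t) (Re (h 0)).
    have := is_deriveZ (Re (h 0)) (@is_derive_id R R t 1).
    by rewrite -[_ *: _]/(_ * _) mulr1.
  exact: is_deriveB.
have uh t : u 0 t <= Re (h 0).
  by apply: hmax; rewrite norm_cexp ltcR ltr_expR.
have Dmono s t : 0 <= s -> s <= t -> t <= pi *+ 2 -> D t <= D s.
  move=> s0 st t2.
  have [|c _ E] := @MVT_derive D (fun t => u 0 t - Re (h 0)) s t st.
    by move=> x /andP[sx xt]; apply: dD; rewrite (le_trans s0 sx) (le_trans xt).
  by rewrite -subr_le0 E mulr_le0_ge0 ?subr_le0 ?subr_ge0.
have Dconst t : 0 <= t <= pi *+ 2 -> D t = D 0.
  move=> /andP[t0 t2]; apply/eqP; rewrite eq_le Dmono //=.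
  apply: le_trans (Dmono _ _ t0 t2 (lexx _)).
  by rewrite /D mulr0; lra.
have pi1 : 0 < (pi : R) < pi *+ 2.
  by rewrite pi_gt0 mulr2n ltrDl pi_gt0.
have [d1 E1] : is_derive (pi : R) 1 D (u 0 pi - Re (h 0)).
  by apply: dD; case/andP: pi1 => /ltW -> /ltW ->.
have [_ E2] : is_derive (pi : R) 1 D 0.
  apply: (@near_eq_is_derive _ _ _ (cst (D 0))).
  have pii : (pi : R) \in `]0, pi *+ 2[ by rewrite in_itv.
  apply: filterS (near_in_itvoo pii) => t; rewrite in_itv /= => /andP[t0 t2].
  by rewrite -(Dconst t) // (ltW t0) (ltW t2).
move: E1; rewrite E2 => /esym/eqP; rewrite subr_eq0 => /eqP <-.
congr (Re (h _)); rewrite /cexp expR0 cospi sinpi mul1r mulr0.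
by apply/eqP; rewrite eq_complex /= oppr0 !eqxx.
Qed.

End RealPartMaximum.

Lemma near_eq_is_diff (K : numFieldType) (V W : normedModType K)
  (f g : V -> W) (x : V) : (\forall y \near x, f y = g y) ->
  differentiable f x -> is_diff x g ('d f x).
Proof.
move=> fg df; apply: approx_is_diff => [|e e0].
  exact: diff_continuous.
have fx : f x = g x by exact: nbhs_singleton fg.
apply: filterS2 fg (differentiable_approx df e0) => y fy.
by rewrite fy fx.
Qed.

(** * Holomorphic functions on compact connected manifolds *)

Section HolomorphicConstant.
Variable R : realType.
Local Open Scope complex_scope.
Local Notation Re := (@complex.Re R).

(** Restrict [f] to the complex line t |-> z0 + t (z0 - z), which meets [z0] at t = 0 and [z] at t =
    -1, and apply [Re_maximum_circle]. *)
Lemma Re_local_maximum (V : normedModType (CC R)) (f : V -> CC R) (z0 : V) :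
  (\forall z \near z0, differentiable f z /\ Re (f z) <= Re (f z0)) ->
  \forall z \near z0, Re (f z) = Re (f z0).
Proof.
move=> /nbhs_normP [r /= r0 rP].
have E0 : 0 < (expR 1)%:C :> CC R by rewrite ltcR expR_gt0.
(* Dividing by e keeps the line inside the ball of radius [r] for all |t| < e. *)
have re0 : 0 < r / (expR 1)%:C by rewrite divr_gt0.
apply/nbhs_normP; exists (r / (expR 1)%:C) => //= z /= zr.
pose v := z0 - z.
have line t : `|t| < (expR 1)%:C -> `|z0 - (z0 + t *: v)| < r.
  move=> t1; rewrite opprD addrA subrr sub0r normrN normrZ.
  apply: (@le_lt_trans _ _ ((expR 1)%:C * `|v|)).
    by rewrite ler_wpM2r // ltW.
  by rewrite mulrC -ltr_pdivlMr.
pose h t := f (z0 + t *: v).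
have dh t : `|t| < (expR 1)%:C -> differentiable h t.
  move=> /line /rP [dft _].
  have dl : differentiable (cst z0 + (fun s : CC R => s *: v)) t.
    apply: differentiableD; first exact: differentiable_cst.
    apply: (@differentiableZl _ _ _ (fun s : CC R => s)).
    exact: (@ex_diff _ _ _ _ _ idfun idfun).
  exact: (@differentiable_comp _ _ _ _ (cst z0 + (fun s : CC R => s *: v)) f).
have := @Re_maximum_circle R h dh; rewrite /h scale0r addr0 scaleN1r /v.
by rewrite subKr; apply=> t /line /rP [].

Qed.

Variables (n : nat) (M : complexManifoldType R n).

(** Scalar counterpart of [holomorphic_on], with the field itself as target in place of a manifold
    with an atlas. *)
Definition holomorphic_function (f : M -> CC R) : Prop :=
  continuous f /\
  forall (c : chart R n M) (x : M), atlas c -> chart_dom c x ->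
    differentiable (fun z => f (chart_inv c z)) (c x).

Lemma Re_continuous : continuous (Re : CC R -> R).
Proof.
move=> z A /nbhs_ballP [e /= e0 eA].
apply/nbhs_normP; exists (e / 2)%:C; first by rewrite /= ltcR divr_gt0.
move=> w /ltW /Re_norm_le zw; apply: eA; rewrite /ball /=.
by move: zw; rewrite raddfB /=; lra.
Qed.

(** Compactness gives a maximum of [Re \o f]. The set where it is attained is closed by continuity
    and open by [Re_local_maximum] in charts, hence everything. *)
Lemma Re_holomorphic_constant (f : M -> CC R) :
  compact [set: M] -> connected [set: M] -> holomorphic_function f ->
  forall x y, Re (f x) = Re (f y).
Proof.
move=> cM conM [cf df] x0 y0.
have cRe : continuous (Re \o f).
  by move=> x; apply: continuous_comp; [exact: cf | exact: Re_continuous].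
have M0 : [set: M] !=set0 by exists x0.
have [m _ mmax] := compact_EVT_max M0 cM (continuous_subspaceT cRe).
pose S := [set x | Re (f x) = Re (f m)].
have ST : S = [set: M].
  apply: conM; first by exists m.
  - exists S; last by rewrite setTI.
    rewrite openE => x Sx; rewrite /interior.
    have [c ac cx] := atlas_cover x.
    have img : \forall z \near c x, (c @` chart_dom c) z.
      by apply: open_nbhs_nbhs; split; [exact: chart_img_open | exists x].
    have loc : \forall z \near c x, Re (f (chart_inv c z)) =
        Re (f (chart_inv c (c x))).
      apply: (@Re_local_maximum _ (fun z => f (chart_inv c z))).
      apply: filterS img => _ [y cy <-]; split; first exact: df.
      by rewrite !chart_mapK // Sx; apply: mmax; rewrite inE.
    have dx : \forall y \near x, chart_dom c y.
      by apply: open_nbhs_nbhs; split => //; exact: chart_dom_open.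
    have := chart_map_continuous cx loc.
    apply: filterS2 dx => y cy /=.
    by rewrite !chart_mapK // Sx.
  - exists S; last by rewrite setTI.
    apply: (@closed_comp _ _ (Re \o f) [set Re (f m)]).
      by move=> x _; exact: cRe.
    exact: closed_eq.
have : S x0 by rewrite ST.
have : S y0 by rewrite ST.
by rewrite /S /= => -> ->.
Qed.

(** The imaginary part of [f] is the real part of -i f, which is holomorphic too. *)
Lemma holomorphic_constant (f : M -> CC R) :
  compact [set: M] -> connected [set: M] -> holomorphic_function f ->
  forall x y, f x = f y.
Proof.
move=> cM conM hf x y.
have hif : holomorphic_function (fun x => - 'i * f x).
  case: hf => cf df; split.
    move=> z; apply: cvgMr; exact: cf.
  move=> c z ac cz; exact: (differentiableZ (- 'i : CC R) (df c z ac cz)).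
have := Re_holomorphic_constant cM conM hf x y.
have := Re_holomorphic_constant cM conM hif x y.
case: (f x) => a b; case: (f y) => a' b' /=.
by move=> E1 E2; congr (_ +i* _); lra.
Qed.

End HolomorphicConstant.

(** * Conjugation in a compact complex Lie group *)

Section CompactComplexLieGroup.
Variables (R : realType) (n : nat) (G : complexLieGroupType R n).

Lemma conjg_continuous :
  continuous (fun xw : G * G => (xw.1 * xw.2 * xw.1^-1)%g).
Proof.
have cm := @mulg_continuous R n G.
have ci (x : G) : {for x, continuous (fun x : G => (x^-1)%g)}.
  by have [] := @invg_holomorphic R n G x I.
move=> [x w].
have c1 : (fun xw : G * G => (xw.1 * xw.2)%g) @ (x, w) --> (x * w)%g.
  exact: (cm (x, w)).
have c2 : (fun xw : G * G => (xw.1^-1)%g) @ (x, w) --> (x^-1)%g.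
  exact: (cvg_comp _ _ (@cvg_fst _ _ (nbhs x) (nbhs w) _) (ci x)).
exact: (cvg_comp _ _ (cvg_pair c1 c2) (cm ((x * w)%g, (x^-1)%g))).
Qed.

Section Orbit.
Variables (e : chart R n G) (w : G).
Hypothesis ae : atlas e.
Hypothesis we : forall x : G, chart_dom e (x * w * x^-1)%g.

Let conj_continuous : continuous (fun x : G => (x * w * x^-1)%g).
Proof.
move=> x.
have cx : (fun x' => (x', w)) @ x --> (x, w).
  exact: (@cvg_pair _ _ _ (nbhs x) (nbhs x) (nbhs w) _ _ _ id (cst w)
    (@cvg_id _ _) (@cst_continuous _ _ w x)).
exact: (cvg_comp _ _ cx (@conjg_continuous (x, w))).
Qed.

(** The axioms give holomorphy of product and inverse in charts, so conjugation is factored through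
    charts at [x * w] and at the inverse of [x]. The factored map agrees with it only near [c x],
    which suffices. *)
Let conj_differentiable (c : chart R n G) (x : G) :
  atlas c -> chart_dom c x ->
  differentiable (fun z => e (chart_inv c z * w * (chart_inv c z)^-1)%g) (c x).
Proof.
move=> ac cx.
have [d ad dxw] := atlas_cover (x * w)%g.
have [dw adw dww] := atlas_cover w.
have [d' ad' dx] := atlas_cover (x^-1)%g.
pose f1 z := d (chart_inv c z * w)%g.
pose f2 z := d' ((chart_inv c z)^-1)%g.
pose F (z : 'rV[CC R]_n * 'rV[CC R]_n) :=
  e (chart_inv d z.1 * chart_inv d' z.2)%g.
have Df1 : differentiable f1 (c x).
  have H := @mulg_holomorphic R n G x w c dw d ac adw ad cx dww dxw.
  (* Right multiplication by [w] is the product restricted to the slice z |-> (z, dw w). *)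
  have P : differentiable (fun z : 'rV[CC R]_n => (z, dw w)) (c x).
    apply: differentiable_pair; last exact: differentiable_cst.
    exact: (@ex_diff _ _ _ _ _ idfun idfun).
  have := differentiable_comp P H; rewrite /comp /=.
  by rewrite chart_mapK.
have Df2 : differentiable f2 (c x).
  have [_ H] := @invg_holomorphic R n G x I.
  exact: H.
have DF : differentiable F (f1 (c x), f2 (c x)).
  rewrite /f1 /f2 chart_mapK //.
  by apply: mulg_holomorphic => //; exact: we.
have DFf : differentiable (fun z => F (f1 z, f2 z)) (c x).
  exact: (differentiable_comp (differentiable_pair Df1 Df2) DF).
apply: (@ex_diff _ _ _ _ _ _ _ (near_eq_is_diff _ DFf)).
have ci : chart_inv c @ c x --> x.
  rewrite -[X in _ --> X](chart_mapK cx).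
  by apply: chart_inv_continuous; exists x.
have near1 : \forall y \near x, chart_dom d (y * w)%g.
  have cy : (fun y => (y, w)) @ x --> (x, w).
    exact: (@cvg_pair _ _ _ (nbhs x) (nbhs x) (nbhs w) _ _ _ id (cst w)
      (@cvg_id _ _) (@cst_continuous _ _ w x)).
  have := cvg_comp _ _ cy (@mulg_continuous R n G (x, w)); apply.
  by apply: open_nbhs_nbhs; split => //; exact: chart_dom_open.
have near2 : \forall y \near x, chart_dom d' (y^-1)%g.
  have [ci' _] := @invg_holomorphic R n G x I; apply: ci'.
  by apply: open_nbhs_nbhs; split => //; exact: chart_dom_open.
have near12 : \forall z \near c x, chart_dom d (chart_inv c z * w)%g /\
    chart_dom d' ((chart_inv c z)^-1)%g.
  exact: (ci _ (filterI near1 near2)).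
apply: filterS near12 => z [z1 z2].
by rewrite /F /f1 /f2 /= !chart_mapK.
Qed.

Lemma conj_coord_holomorphic (j : 'I_n) :
  holomorphic_function (fun x : G => e (x * w * x^-1)%g 0 j : CC R).
Proof.
split=> [x|c x ac cx].
  have ce := chart_map_continuous (we x).
  have := cvg_comp _ _ (@conj_continuous x) ce => H.
  exact: (cvg_comp _ _ H (@coord_continuous _ _ _ _ _ _)).
exact: (differentiable_comp (conj_differentiable ac cx)
  (differentiable_coord _ _ _)).
Qed.

End Orbit.

Hypothesis G_compact : compact [set: G].
Hypothesis G_connected : connected [set: G].

(* By compactness the whole conjugacy class of an element near 1 stays in one
   chart, where conjugation becomes a C^n-valued holomorphic function on G. *)
Lemma conj_chart_constant (e : chart R n G) : atlas e -> chart_dom e 1%g ->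
  \forall w \near (1%g : G), forall x : G, e (x * w * x^-1)%g = e w.
Proof.
move=> ae e1.
have : \forall w \near (1%g : G),
    [set: G] `<=` (fun x => chart_dom e (x * w * x^-1)%g).
  (* Tube argument: since every [x] conjugates 1 to 1, continuity at (x, 1) gives a neighbourhood of
     1 that works for all points near [x], and compactness makes it uniform. *)
  move/compact_near_coveringP: G_compact; apply => x _.
  have H : (fun xw : G * G => (xw.1 * xw.2 * xw.1^-1)%g) @ (x, 1%g) --> (1%g : G).
    have xE : (x * 1 * x^-1)%g = 1%g by rewrite mulg1 mulgV.
    by rewrite -[X in _ --> X]xE; exact: (@conjg_continuous (x, 1%g)).
  have : nbhs (1%g : G) (chart_dom e).
    by apply: open_nbhs_nbhs; split => //; exact: chart_dom_open.
  by move=> /H [[A B] [/= xA B1] AB]; exists (A, B) => // -[y w] [] Ay Bw;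
    apply: (AB (y, w)).
apply: filterS => w we x.
have we' y : chart_dom e (y * w * y^-1)%g by exact: we.
apply/rowP => j.
have := holomorphic_constant G_compact G_connected
  (conj_coord_holomorphic ae we' j) x 1%g.
by rewrite mul1g invg1 mulg1.
Qed.

(** By [conj_chart_constant], the map differentiated in [Ad] coincides with the identity near the
    base point. *)
Lemma Ad_trivial (x : G) (Y : 'rV[CC R]_n) : Ad x Y = Y.
Proof.
have [a1 d1] : atlas (chart1 G) /\ chart_dom (chart1 G) 1%g.
  by rewrite /chart1; case: cid2.
rewrite /Ad.
have img : \forall z \near chart1 G 1%g,
    (chart1 G @` chart_dom (chart1 G)) z.
  by apply: open_nbhs_nbhs; split; [exact: chart_img_open | exists 1%g].
have ci : chart_inv (chart1 G) @ chart1 G 1%g --> (1%g : G).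
  rewrite -[X in _ --> X](chart_mapK d1).
  by apply: chart_inv_continuous; exists 1%g.
have idE : \forall z \near chart1 G 1%g,
    idfun z = chart1 G (x * chart_inv (chart1 G) z * x^-1)%g.
  have cst_near : \forall z \near chart1 G 1%g, forall x : G,
      chart1 G (x * chart_inv (chart1 G) z * x^-1)%g =
      chart1 G (chart_inv (chart1 G) z).
    exact: (ci _ (conj_chart_constant a1 d1)).
  apply: filterS2 img cst_near => _ [y dy <-] /(_ x) ->.
  by rewrite chart_mapK.
have Did : is_diff (chart1 G 1%g) (@idfun 'rV[CC R]_n) idfun.
  exact: is_diff_id.
have [_ ->] := near_eq_is_diff idE (@ex_diff _ _ _ _ _ _ _ Did).
by rewrite (@diff_val _ _ _ _ _ _ _ Did).
Qed.

Lemma lie_bracket_trivial (X Y : 'rV[CC R]_n) :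
  @lie_bracket R n G X Y = 0.
Proof.
rewrite /lie_bracket.
have -> : (fun z => Ad (chart_inv (chart1 G) z) Y) = cst Y.
  by apply/funext => z; exact: Ad_trivial.
by rewrite diff_cst.
Qed.

End CompactComplexLieGroup.

Theorem proposition6p6 (R : realType) (n : nat)
  (Gt G : complexLieGroupType R n) (Gamma : set Gt) (p : Gt -> G)
  (Gt_simply_connected : simply_connected R Gt)
  (Gamma_normal : normal_subgroup Gamma)
  (Gamma_discrete : discrete_subset Gamma)
  (G_quotient : is_quotient_by Gamma p)
  (G_connected : connected [set: G])
  (G_almost_abelian : almost_abelian_group G) :
  ~ compact [set: G].
Proof.
move=> G_compact; have [nonabelian _] := G_almost_abelian; apply: nonabelian.
by split=> X Y _ _; rewrite lie_bracket_trivial ?memvf.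
Qed.
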